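(* Let $0<q<1$, let $\{p_n(z;q)\}_{n\in\mathbb N_0}$ be an odd $q$-Lidstone polynomial sequence of type I, let $A_q$ be its odd $q$-Lidstone-type I matrix, $B_q=A_q^{-1}$, and let $\Pi_q=[\pi_{ij}]_{i,j\in\mathbb N_0}$ be the production matrix of $B_q$. Then $$p_0(z;q)=\frac{1}{\beta_0}z,\qquad p_{n+1}(z;q)= \frac{1}{\pi_{n(n+1)}}\Big[z^{2}p_{n}(z;q)-\sum_{k=0}^{n} \pi_{nk}\, p_k(z;q)\Big]\quad (n\in \mathbb{N}_0).$$
   Context: Fix $0<q<1$. Put $[m]_q=\frac{1-q^m}{1-q}$, $[m]_q!=\prod_{j=1}^m[j]_q$, $[0]_q!=1$, and ${n \brack k}_q=\frac{[n]_q!}{[k]_q!\,[n-k]_q!}$ for $0\le k\le n$. $\mathbb N=\{1,2,\dots\}$, $\mathbb N_0=\mathbb N\cup\{0\}$. The Jackson $q$-derivative is $D_qf(z)=\frac{f(qz)-f(z)}{(q-1)z}$ for $z\ne0$ and $D_qf(0)=f'(0)$, so $D_qz^m=[m]_qz^{m-1}$. An odd $q$-Lidstone polynomial sequence of type I (class $q$OLS-I) is a sequence $\{p_n(z;q)\}_{n\in\mathbb N_0}$ of polynomials in $z$ with real coefficients such that $D_q^2p_n(z;q)=[2n+1]_q[2n]_q\,p_{n-1}(z;q)$ for $n\in\mathbb N$, $p_n(0;q)=0$ for $n\in\mathbb N_0$, and $p_0(z;q)=\alpha_0z$ with $\alpha_0\in\mathbb R\setminus\{0\}$. Its associated numerical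 sequence is $\alpha_{2n}:=D_qp_n(0;q)$, and $p_n(z;q)=\sum_{k=0}^n {2n+1 \brack 2k+1}_q\frac{\alpha_{2(n-k)}}{[2(n-k)+1]_q}z^{2k+1}$. The sequence $(\beta_{2n})_{n\ge0}$ is the unique real sequence with $\sum_{j=0}^n \frac{\beta_{2j}\,\alpha_{2(n-j)}}{[2j+1]_q!\,[2(n-j)+1]_q!}=\delta_{n0}$ for all $n\in\mathbb N_0$. The matrix of $\{p_n\}_n$ is the infinite lower triangular matrix $A_q=[a_{ij}]_{i,j\in\mathbb N_0}$ with $a_{ij}={2i+1 \brack 2j+1}_q\frac{\alpha_{2(i-j)}}{[2(i-j)+1]_q}$ for $i\ge j$ and $0$ otherwise. Its inverse $B_q=[b_{ij}]$ is lower triangular with $b_{ij}={2i+1 \brack 2j+1}_q\frac{\beta_{2(i-j)}}{[2(i-j)+1]_q}$ for $i\ge j$. The production matrix of a nonsingular infinite lower triangular matrix $M$ is $\Pi_M=M^{-1}\overline M$, where $\overline M$ is $M$ with its first row removed; thus for $M=B_q$ one has $\pi_{ij}=\sum_{n=0}^i a_{in}\,b_{(n+1)j}$. *)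

(* Defs.v *)
From HB Require Import structures.
From mathcomp Require Import all_boot all_order all_algebra.
From mathcomp Require Import all_classical all_reals all_analysis.

Set Implicit Arguments.
Unset Strict Implicit.
Unset Printing Implicit Defensive.

Import Order.TTheory GRing.Theory Num.Theory.
Import numFieldNormedType.Exports.

Local Open Scope classical_set_scope.
Local Open Scope ring_scope.

Section QCalculus.
Variables (R : realType) (q : R).

Definition qnum (m : nat) : R := (1 - q ^+ m) / (1 - q).

Definition qfact (m : nat) : R := \prod_(1 <= j < m.+1) qnum j.

(* Only meaningful for k <= n, because n - k is truncated subtraction. *)
Definition qbinom (n k : nat) : R := qfact n / (qfact k * qfact (n - k)).

(* The Jackson q-derivative of a function; at 0 it is the ordinary one. *)
Definition jackson (f : R -> R) : R -> R := fun z =>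
  if z == 0 then derive1 f 0 else (f (q * z) - f z) / ((q - 1) * z).

End QCalculus.

Section InfiniteTriangularMatrices.
Variable R : realType.
Implicit Types M N : nat -> nat -> R.

Definition lower_triangular M := forall i j, (i < j)%N -> M i j = 0.

(* The product M N for lower triangular M (N may be arbitrary): the entries   *)
(* M i k with k > i vanish, so the sum stops at k = i.                        *)
Definition ltmx_mul M N : nat -> nat -> R :=
  fun i j => \sum_(k < i.+1) M i k * N k j.

Definition ltmx_is_inv M N :=
  [/\ lower_triangular N,
      forall i j, ltmx_mul M N i j = (i == j)%:R &
      forall i j, ltmx_mul N M i j = (i == j)%:R].

(* The inverse of a nonsingular lower triangular matrix, which is unique; it  *)
(* takes the irrelevant value 0 when there is no inverse.                     *)
Definition ltmx_inv M : nat -> nat -> R :=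
  xget (fun _ _ => 0) [set N | ltmx_is_inv M N].

Definition drop_first_row M : nat -> nat -> R := fun i j => M i.+1 j.

Definition production_mx M : nat -> nat -> R :=
  ltmx_mul (ltmx_inv M) (drop_first_row M).

End InfiniteTriangularMatrices.

Section OddQLidstone.
Variables (R : realType) (q : R).
Implicit Type p : nat -> {poly R}.

Definition qOLS_I p :=
  [/\ forall n, (0 < n)%N -> forall z : R,
        jackson q (jackson q (fun x => (p n).[x])) z =
        qnum q n.*2.+1 * qnum q n.*2 * (p n.-1).[z],
      forall n, (p n).[0] = 0 &
      exists2 alpha0 : R, alpha0 != 0 & p 0%N = alpha0 *: 'X].

(* The associated numerical sequences are indexed by half their usual index:  *)
(* qalpha p n is alpha_{2n} and qbeta p n is beta_{2n}.                       *)
Definition qalpha p (n : nat) : R := jackson q (fun x => (p n).[x]) 0.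

Definition is_qbeta p (beta : nat -> R) :=
  forall n, \sum_(j < n.+1) beta j * qalpha p (n - j) /
              (qfact q j.*2.+1 * qfact q (n - j).*2.+1) = (n == 0%N)%:R.

(* The unique sequence satisfying is_qbeta p (unique when alpha_0 != 0).      *)
Definition qbeta p : nat -> R := xget (fun _ => 0) [set beta | is_qbeta p beta].

Definition qOLS_mx p : nat -> nat -> R := fun i j =>
  if (j <= i)%N then
    qbinom q i.*2.+1 j.*2.+1 * (qalpha p (i - j) / qnum q (i - j).*2.+1)
  else 0.

End OddQLidstone.

(* Main.v *)
(** A type I odd q-Lidstone sequence is the image of the odd monomials
    z^(2k+1) under its matrix A, so that z^(2k+1) is the image of the
    sequence under B = A^-1.  Multiplication by z^2 shifts the odd monomials
    by one, hence z^2 p_n = sum_(j <= n+1) pi_(nj) p_j with pi the production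
    matrix A (shift B) of B; solving for the last term gives the recurrence. *)
Require Import Defs.
From HB Require Import structures.
From mathcomp Require Import all_boot all_order all_algebra.
From mathcomp Require Import all_classical all_reals all_analysis.
From mathcomp Require Import ring.

Set Implicit Arguments.
Unset Strict Implicit.
Unset Printing Implicit Defensive.

Import Order.TTheory GRing.Theory Num.Theory.
Local Open Scope ring_scope.

(** * Algebra and inverses of infinite lower triangular matrices *)

Section TriangularMatrices.
Variable R : realType.
Implicit Types (M N P : nat -> nat -> R) (V : lmodType R).

(** Forward substitution: row [i] determines [x i] from the earlier unknowns. *)
Lemma ltmx_solve M (b : nat -> R) : (forall i, M i i != 0) ->
  exists x : nat -> R, forall i, \sum_(k < i.+1) M i k * x k = b i.
Proof.
move=> Mii.
pose step m (s : seq R) := (b m - \sum_(k < m) M m k * s`_k) / M m m.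
(* Carrying the list of the first [n] unknowns makes this course-of-values recursion structural. *)
pose prefix := fix F n := if n is m.+1 then rcons (F m) (step m (F m)) else [::].
have size_prefix n : size (prefix n) = n.
  by elim: n => //= n IHn; rewrite size_rcons IHn.
pose x i := (prefix i.+1)`_i.
have prefixE n k : (k < n)%N -> (prefix n)`_k = x k.
  elim: n => // n IHn; rewrite ltnS leq_eqVlt => /predU1P[->//|kn].
  by rewrite /= nth_rcons size_prefix kn IHn.
exists x => i; rewrite big_ord_recr /= {2}/x /= nth_rcons size_prefix ltnn eqxx.
rewrite /step mulrC divfK // addrC; under [X in _ - X]eq_bigr => k _ do
  rewrite prefixE //.
by rewrite subrK.
Qed.

(* [d] bounds the number of nonzero superdiagonals of [N]: 0 for a lower
   triangular matrix, 1 for such a matrix without its first row. *)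
Lemma ltmx_combA V (d : nat) M N (e : nat -> V) i :
    (forall k l, (d + k < l)%N -> N k l = 0) ->
  \sum_(k < i.+1) M i k *: \sum_(l < (d + k).+1) N k l *: e l =
  \sum_(l < (d + i).+1) ltmx_mul M N i l *: e l.
Proof.
move=> N0; under [RHS]eq_bigr => l _ do rewrite scaler_suml.
rewrite exchange_big; apply: eq_bigr => k _ /=.
under [RHS]eq_bigr => l _ do rewrite -scalerA.
rewrite -scaler_sumr; congr (_ *: _).
have ki : ((d + k).+1 <= (d + i).+1)%N by rewrite ltnS leq_add2l -ltnS.
rewrite (big_ord_widen _ (fun l => N k l *: e l) ki) big_mkcond.
apply: eq_bigr => l _; case: ifPn => //; rewrite -leqNgt => /N0 ->.
by rewrite scale0r.
Qed.

Lemma ltmx_mulA M N P : lower_triangular N ->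
  ltmx_mul (ltmx_mul M N) P = ltmx_mul M (ltmx_mul N P).
Proof.
move=> Nlt; apply/funext => i; apply/funext => j; apply/esym.
(* Column [j] of [P] serves as the sequence of vectors, in [R] as a module over itself. *)
exact: (@ltmx_combA R^o 0 M N (fun k => P k j) i Nlt).
Qed.

Lemma ltmx_mulI V M (e : nat -> V) i :
  (forall j, M i j = (i == j)%:R) -> \sum_(k < i.+1) M i k *: e k = e i.
Proof.
move=> Mi; rewrite big_ord_recr /= Mi eqxx scale1r big1 ?add0r // => k _.
by rewrite Mi gtn_eqF // scale0r.
Qed.

Lemma ltmx_mul1l M N : (forall i j, M i j = (i == j)%:R) -> ltmx_mul M N = N.
Proof.
move=> M1; apply/funext => i; apply/funext => j.
exact: (@ltmx_mulI R^o M (fun k => N k j) i).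
Qed.

Lemma ltmx_mul1r M N : lower_triangular M ->
  (forall i j, N i j = (i == j)%:R) -> ltmx_mul M N = M.
Proof.
move=> Mlt N1; apply/funext => i; apply/funext => j; rewrite /ltmx_mul.
under eq_bigr => k _ do rewrite N1.
have [ji|ij] := leqP j i; last first.
  rewrite Mlt // big1 // => k _.
  by rewrite ltn_eqF ?mulr0 // (leq_ltn_trans _ ij) // -ltnS.
rewrite (bigD1 (Ordinal (ji : (j < i.+1)%N))) //= eqxx mulr1 big1 ?addr0 //.
by move=> k; rewrite -val_eqE /= => /negPf ->; rewrite mulr0.
Qed.

Lemma ltmx_mul_diag M N i : lower_triangular N ->
  ltmx_mul M N i i = M i i * N i i.
Proof.
move=> Nlt; rewrite /ltmx_mul big_ord_recr /= big1 ?add0r // => k _.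
by rewrite Nlt ?mulr0.
Qed.

Lemma ltmx_right_inv M : (forall i, M i i != 0) ->
  exists2 N, lower_triangular N & forall i j, ltmx_mul M N i j = (i == j)%:R.
Proof.
move=> Mii; have solvable j := ltmx_solve (fun i => (i == j)%:R) Mii.
pose N i j := sval (cid (solvable j)) i.
have MN i j : ltmx_mul M N i j = (i == j)%:R by exact: (svalP (cid (solvable j)) i).
(* Column [j] of [N] solves the system with the [j]-th unit vector on the right. Above the diagonal,
   induction reduces row [i] to [M i i * N i j = 0]. *)
exists N => // i j; elim/ltn_ind: i => i IHi ij.
have /eqP := MN i j; rewrite /ltmx_mul big_ord_recr /= big1 => [|k _].
  by rewrite add0r ltn_eqF // mulf_eq0 (negPf (Mii i)) => /eqP.
by rewrite IHi ?mulr0 // (ltn_trans _ ij).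
Qed.

(** A right inverse [N] has a right inverse [P] of its own, and M = M(NP) = (MN)P = P makes [N]
    two-sided. *)
Lemma ltmx_is_inv_exists M : lower_triangular M -> (forall i, M i i != 0) ->
  exists N, ltmx_is_inv M N.
Proof.
move=> Mlt Mii; have [N Nlt MN] := ltmx_right_inv Mii.
have Nii i : N i i != 0.
  apply/eqP => Ni0; have /eqP := MN i i.
  by rewrite ltmx_mul_diag // Ni0 mulr0 eqxx eq_sym oner_eq0.
have [P Plt NP] := ltmx_right_inv Nii.
exists N; split=> //.
suff -> : M = P by [].
by rewrite -(ltmx_mul1r Mlt NP) -ltmx_mulA // ltmx_mul1l.
Qed.

Lemma ltmx_invP M : lower_triangular M -> (forall i, M i i != 0) ->
  ltmx_is_inv M (ltmx_inv M).
Proof.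
by move=> Mlt Mii; have := xgetPex (fun _ _ => 0) (ltmx_is_inv_exists Mlt Mii).
Qed.

(** Inverses are unique. This turns the inverse of B inside its production matrix back into A. *)
Lemma ltmx_invK M : lower_triangular M -> (forall i, M i i != 0) ->
  ltmx_inv (ltmx_inv M) = M.
Proof.
move=> Mlt Mii; have [Nlt MN NM] := ltmx_invP Mlt Mii.
apply: xget_unique => // P [Plt NP PN].
by rewrite -(ltmx_mul1r Plt NM) -ltmx_mulA // ltmx_mul1l.
Qed.

Lemma ltmx_inv_diag M i : lower_triangular M -> (forall i, M i i != 0) ->
  ltmx_inv M i i != 0.
Proof.
move=> Mlt Mii; have [Nlt MN _] := ltmx_invP Mlt Mii.
apply/eqP => Ni0; have /eqP := MN i i.
by rewrite ltmx_mul_diag // Ni0 mulr0 eqxx eq_sym oner_eq0.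
Qed.

End TriangularMatrices.

(** * q-numbers and the Jackson derivative of polynomials *)

Section OddLidstone.
Variables (R : realType) (q : R).
Hypotheses (q_gt0 : 0 < q) (q_lt1 : q < 1).

Let q1_neq0 : 1 - q != 0. Proof. by rewrite subr_eq0 gt_eqF. Qed.

Lemma qnum_neq0 m : (0 < m)%N -> qnum q m != 0.
Proof.
move=> m0; rewrite mulf_neq0 ?invr_eq0 // subr_eq0 gt_eqF //.
by rewrite exprn_ilt1 ?ltW // -lt0n.
Qed.

Lemma qnum1 : qnum q 1 = 1. Proof. by rewrite /qnum expr1 divff. Qed.

Lemma qfactS m : qfact q m.+1 = qfact q m * qnum q m.+1.
Proof. by rewrite /qfact big_nat_recr. Qed.

Lemma qfact0 : qfact q 0 = 1. Proof. by rewrite /qfact big_geq. Qed.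

Lemma qfact_neq0 m : qfact q m != 0.
Proof.
elim: m => [|m IHm]; first by rewrite qfact0 oner_neq0.
by rewrite qfactS mulf_neq0 // qnum_neq0.
Qed.

Lemma qbinom_neq0 n k : qbinom q n k != 0.
Proof. by rewrite /qbinom mulf_neq0 ?invr_eq0 ?mulf_neq0 ?qfact_neq0. Qed.

Lemma qbinomn1 n : qbinom q n.+1 1 = qnum q n.+1.
Proof.
by rewrite /qbinom subSS subn0 !qfactS qfact0 qnum1 !mul1r mulrAC divff ?mul1r
  ?qfact_neq0.
Qed.

(** The q-analogue of the absorption identity for binomial coefficients. *)
Lemma qbinom_absorb n k :
  qnum q k.+1 * qbinom q n.+1 k.+1 = qnum q n.+1 * qbinom q n k.
Proof.
rewrite /qbinom subSS !qfactS.
have := (qfact_neq0 k, qfact_neq0 (n - k), @qnum_neq0 k.+1 isT) => -[[]].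
move: (qfact q k) (qfact q (n - k)) (qnum q k.+1) => a b c a0 b0 c0.
by field; rewrite a0 b0 c0.
Qed.

Definition qderiv (p : {poly R}) : {poly R} :=
  \poly_(i < size p) (qnum q i.+1 * p`_i.+1).

Lemma coef_qderiv p i : (qderiv p)`_i = qnum q i.+1 * p`_i.+1.
Proof.
rewrite coef_poly; case: ltnP => // pi.
by rewrite nth_default ?mulr0 // (leq_trans pi).
Qed.

Lemma jackson_horner (p : {poly R}) :
  jackson q (fun x => p.[x]) = (fun x => (qderiv p).[x]).
Proof.
apply/funext => z; rewrite /jackson; case: eqVneq => [->|z0].
  rewrite -[derive1 _]derivE !horner_coef0 coef_qderiv coef_deriv mulr1n.
  by rewrite qnum1 mul1r.
(* One extra zero coefficient lets the constant term split off and cancel, leaving the index range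
   of [qderiv]. *)
rewrite !(@horner_coef_wide _ (size p).+1 p) // !big_ord_recl !expr0.
rewrite opprD addrACA subrr add0r -sumrB horner_poly mulr_suml.
apply: eq_bigr => i _; rewrite lift0 /qnum exprMn exprS [z ^+ _]exprS.
have q1' : q - 1 != 0 by rewrite -opprB oppr_eq0.
by field; rewrite z0 q1_neq0.
Qed.

(** The naturals embed injectively in [R], giving the difference as many roots as its size. *)
Lemma horner_inj (p r : {poly R}) : (forall z, p.[z] = r.[z]) -> p = r.
Proof.
move=> pr; apply/eqP; rewrite -subr_eq0; apply/eqP.
pose rs := [seq (i%:R : R) | i <- iota 0 (size (p - r))].
apply: (@roots_geq_poly_eq0 _ _ rs).
- by apply/allP => x _; rewrite rootE hornerD hornerN pr subrr.
- by rewrite map_inj_uniq ?iota_uniq //; apply: mulrIn; rewrite oner_eq0.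
- by rewrite size_map size_iota.
Qed.

(** * Coefficients of an odd q-Lidstone sequence *)

Variable p : nat -> {poly R}.
Hypothesis p_OLS : qOLS_I q p.

Lemma qalphaE n : qalpha q p n = (p n)`_1.
Proof.
by rewrite /qalpha jackson_horner horner_coef0 coef_qderiv qnum1 mul1r.
Qed.

Lemma qalpha0_neq0 : qalpha q p 0 != 0.
Proof.
have [_ _ [a a0 p0]] := p_OLS.
by rewrite qalphaE p0 coefZ coefX mulr1.
Qed.

(** The defining equation, read on coefficients: it fixes those of [p n.+1] from index 2 on. *)
Lemma qOLS_coefSS n i :
  qnum q i.+1 * (qnum q i.+2 * (p n.+1)`_i.+2) =
  qnum q n.+1.*2.+1 * qnum q n.+1.*2 * (p n)`_i.
Proof.
have [rec _ _] := p_OLS; have {rec} /(_ n.+1 isT) := rec => /= rec.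
rewrite -!coef_qderiv -coefZ; suff -> : qderiv (qderiv (p n.+1)) =
    (qnum q n.+1.*2.+1 * qnum q n.+1.*2) *: p n by [].
by apply: horner_inj => z; rewrite hornerZ -rec !jackson_horner.
Qed.

Lemma qOLS_coef_even n k : (p n)`_k.*2 = 0.
Proof.
have [_ p0 [a _ pa]] := p_OLS.
elim: n k => [|n IHn] [|k]; try by rewrite -horner_coef0 p0.
  by rewrite pa coefZ coefX mulr0.
apply: (mulfI (@qnum_neq0 k.*2.+2 isT)); apply: (mulfI (@qnum_neq0 k.*2.+1 isT)).
by rewrite qOLS_coefSS IHn !mulr0.
Qed.

(** Induction on [n]: the coefficient of z is [qalpha] by definition, and the higher ones follow
    from [qOLS_coefSS] with absorption applied twice. *)
Lemma qOLS_coef_odd n k : (p n)`_k.*2.+1 = qOLS_mx q p n k.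
Proof.
have [_ _ [a _ pa]] := p_OLS.
elim: n k => [|n IHn] [|k].
- rewrite /qOLS_mx /= subnn -qalphaE /qbinom subnn qfact0 qnum1.
  by rewrite mulr1 divr1 divff ?mul1r // qfact_neq0.
- by rewrite /qOLS_mx pa coefZ coefX mulr0.
- rewrite /qOLS_mx subn0 -qalphaE qbinomn1 mulrC divfK //.
  exact: qnum_neq0.
apply: (mulfI (@qnum_neq0 k.*2.+3 isT)); apply: (mulfI (@qnum_neq0 k.*2.+2 isT)).
rewrite qOLS_coefSS IHn /qOLS_mx ltnS subSS !doubleS.
case: leqP => kn; last by rewrite !mulr0.
rewrite (mulrA (qnum q k.*2.+3)) qbinom_absorb mulrCA -(mulrA (qnum q n.*2.+3)).
rewrite (mulrCA (qnum q k.*2.+2)) (mulrA (qnum q k.*2.+2)) qbinom_absorb.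
by rewrite [LHS]mulrCA !mulrA.
Qed.

Lemma qOLS_mx_lower : lower_triangular (qOLS_mx q p).
Proof. by move=> i j ij; rewrite /qOLS_mx leqNgt ij. Qed.

Lemma qOLS_mx_diag i : qOLS_mx q p i i != 0.
Proof.
rewrite /qOLS_mx leqnn subnn qnum1 divr1.
by rewrite mulf_neq0 ?qbinom_neq0 ?qalpha0_neq0.
Qed.

Lemma qOLS_expansion n :
  p n = \sum_(k < n.+1) qOLS_mx q p n k *: 'X^(k.*2.+1).
Proof.
apply/polyP => i; rewrite coef_sum.
under eq_bigr => k _ do rewrite coefZ coefXn.
rewrite -[i]odd_double_half; case: (odd i) => /=; last first.
  rewrite add0n qOLS_coef_even big1 // => k _.
  suff -> : (i./2.*2 == k.*2.+1) = false by rewrite mulr0.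
  by apply/eqP => /(congr1 odd); rewrite /= !odd_double.
rewrite add1n qOLS_coef_odd; set j := i./2.
under eq_bigr => k _ do rewrite eqSS (inj_eq double_inj).
have [jn|nj] := leqP j n; last first.
  rewrite qOLS_mx_lower // big1 // => k _.
  by rewrite gtn_eqF ?mulr0 // (leq_ltn_trans _ nj) // -ltnS.
rewrite (bigD1 (Ordinal (jn : (j < n.+1)%N))) //= eqxx mulr1 big1 ?addr0 //.
by move=> k; rewrite -val_eqE /= eq_sym => /negPf ->; rewrite mulr0.
Qed.

(** * Multiplication by z^2 and the production matrix *)

Lemma odd_monomial_expansion m :
  'X^(m.*2.+1) = \sum_(j < m.+1) ltmx_inv (qOLS_mx q p) m j *: p j.
Proof.
have [_ _ BA] := ltmx_invP qOLS_mx_lower qOLS_mx_diag.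
under eq_bigr => j _ do rewrite qOLS_expansion.
have -> := @ltmx_combA R _ 0 (ltmx_inv (qOLS_mx q p)) (qOLS_mx q p)
  (fun k => 'X^(k.*2.+1)) m qOLS_mx_lower.
by rewrite (ltmx_mulI (fun k => 'X^(k.*2.+1))).
Qed.

Lemma qOLS_mulX2 n :
  'X^2 * p n =
  \sum_(j < n.+2) production_mx (ltmx_inv (qOLS_mx q p)) n j *: p j.
Proof.
have [Blt _ _] := ltmx_invP qOLS_mx_lower qOLS_mx_diag.
rewrite {1}qOLS_expansion mulr_sumr.
under eq_bigr => k _ do
  rewrite -scalerAr -exprD addnC !addnS addn0 -doubleS odd_monomial_expansion.
rewrite /production_mx (ltmx_invK qOLS_mx_lower qOLS_mx_diag).
(* Row [k] of the shifted matrix is row [k.+1] of B, hence one superdiagonal. *)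
apply: (@ltmx_combA R _ 1 _ (drop_first_row _) p n) => k l kl.
exact: Blt.
Qed.

(** Only the last term of the sum survives: the product of the diagonal entries [n] of A and [n.+1]
    of B. *)
Lemma production_mx_superdiag n :
  production_mx (ltmx_inv (qOLS_mx q p)) n n.+1 != 0.
Proof.
have [Blt _ _] := ltmx_invP qOLS_mx_lower qOLS_mx_diag.
rewrite /production_mx (ltmx_invK qOLS_mx_lower qOLS_mx_diag) /ltmx_mul.
rewrite big_ord_recr /= big1 ?add0r => [|k _].
  by rewrite mulf_neq0 ?qOLS_mx_diag // (ltmx_inv_diag _ qOLS_mx_lower qOLS_mx_diag).
by rewrite [drop_first_row _ _ _]Blt ?mulr0 // ltnS.
Qed.

(** Ensures that [qbeta] is a genuine solution and not the default value of [xget]. *)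
Lemma is_qbeta_exists : exists beta, is_qbeta q p beta.
Proof.
(* The system is triangular in the unknowns beta_(2k) / [2k+1]_q!. *)
pose T i k := qalpha q p (i - k) / qfact q (i - k).*2.+1.
have Tii i : T i i != 0.
  by rewrite /T subnn mulf_neq0 ?qalpha0_neq0 ?invr_eq0 ?qfact_neq0.
have [x Tx] := ltmx_solve (fun n => (n == 0%N)%:R) Tii.
exists (fun k => x k * qfact q k.*2.+1) => n; rewrite -[RHS]Tx.
apply: eq_bigr => k _; rewrite /T.
have := (qfact_neq0 k.*2.+1, qfact_neq0 (n - k).*2.+1) => -[? ?].
by field; apply/andP.
Qed.

Lemma qbeta0 : qbeta q p 0 = (qalpha q p 0)^-1.
Proof.
have : is_qbeta q p (qbeta q p).
  exact: (xgetPex (fun _ => 0) is_qbeta_exists).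
move=> /(_ 0%N); rewrite big_ord_recl big_ord0 addr0 subnn.
rewrite /= qfactS qfact0 qnum1 !mulr1 divr1 => ab1.
by apply: (mulIf qalpha0_neq0); rewrite ab1 mulVf // qalpha0_neq0.
Qed.

End OddLidstone.

Theorem theorem2p22 (R : realType) (q : R) (p : nat -> {poly R})
    (q_gt0 : 0 < q) (q_lt1 : q < 1) (p_OLS : qOLS_I q p) :
  let A := qOLS_mx q p in
  let B := ltmx_inv A in
  let Pi := production_mx B in
  p 0%N = (1 / qbeta q p 0) *: 'X /\
  forall n : nat,
    p n.+1 = (1 / Pi n n.+1) *:
      ('X^2 * p n - \sum_(0 <= k < n.+1) Pi n k *: p k).
Proof.
move=> A B Pi; split.
  have [_ _ [a a0 p0]] := p_OLS.
  by rewrite qbeta0 // div1r invrK qalphaE // p0 coefZ coefX mulr1.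
(* Splitting off the term of index [n.+1] leaves exactly the sum being subtracted. *)
move=> n; rewrite (qOLS_mulX2 q_gt0 q_lt1 p_OLS) big_ord_recr /= big_mkord.
rewrite addrAC subrr add0r scalerA div1r mulVf ?scale1r //.
exact: (production_mx_superdiag q_gt0 q_lt1 p_OLS).
Qed.
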